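(* Let $G$ be a finite simple graph on $n \ge 2$ nodes with algebraic connectivity $\lambda_2$, and let $\ell \ge 2$ be an integer. Let $s_\ell$ denote the number of nodes of $G$ of eccentricity at most $\ell$. Then $$\lambda_{2} \ge \frac{4\, s_\ell}{\left(\ell-2+\frac{4}{n}\right) n^2}.$$
   Context: The distance between two nodes of $G$ is the number of edges in a shortest path joining them, and is $\infty$ if there is no such path. The eccentricity of a node is the maximum of its distances to the nodes of $G$ (so it is $\infty$ for every node if $G$ is disconnected, in which case $s_\ell=0$). The Laplacian matrix of $G$ is $L(G)=D-A$, where $A$ is the adjacency matrix and $D$ is the diagonal matrix with $D(i,i)=\sum_j A(i,j)$. The algebraic connectivity $\lambda_2$ is the second smallest eigenvalue of $L(G)$, eigenvalues being counted with multiplicity (the smallest eigenvalue is $0$). *)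

(* Defs.v *)
From mathcomp Require Import all_boot all_order all_algebra.
From mathcomp Require Import constructive_ereal.
From mathcomp Require Import polyrcf complex.

Set Implicit Arguments.
Unset Strict Implicit.
Unset Printing Implicit Defensive.

Import Order.TTheory GRing.Theory Num.Theory.
Local Open Scope ring_scope.

(* A simple graph is a symmetric irreflexive relation e on a finite type T. *)

Section Distance.
Variables (T : finType) (e : rel T).

Definition has_path_of_length (k : nat) (x y : T) : bool :=
  [exists p : k.-tuple T, [&& path e x p, last x p == y & uniq (x :: p)]].

Variable R : rcfType.

(* A path has distinct nodes, hence fewer than #|T| edges; the minimum over
   the empty set is +oo. *)
Definition graph_dist (x y : T) : \bar R :=
  \big[mine/+oo%E]_(k < #|T| | has_path_of_length k x y) k%:R%:E.

Definition eccentricity (x : T) : \bar R :=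
  \big[maxe/-oo%E]_(y : T) graph_dist x y.

Definition num_ecc_le (l : nat) : nat :=
  #|[set x : T | (eccentricity x <= l%:R%:E)%E]|.

End Distance.

Section Laplacian.
Variables (T : finType) (e : rel T) (R : rcfType).

(* The nodes are numbered by the enumeration of T. *)
Definition adjacency_mx : 'M[R]_#|T| :=
  \matrix_(i, j) (e (enum_val i) (enum_val j))%:R.

Definition degree_mx : 'M[R]_#|T| :=
  diag_mx (\row_i \sum_j adjacency_mx i j).

Definition laplacian : 'M[R]_#|T| := degree_mx - adjacency_mx.

End Laplacian.

(* [rootsR p] lists the distinct roots of p in increasing order, so this is the
   increasing list of the eigenvalues of A in R, each repeated according to its
   multiplicity; [spectrum_sym] checks that it is complete when A is symmetric. *)
Definition spectrum (R : rcfType) (n : nat) (A : 'M[R]_n) : seq R :=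
  flatten [seq nseq (mup x (char_poly A)) x | x <- rootsR (char_poly A)].

Lemma spectrumE (R : rcfType) n (A : 'M[R]_n) (s : seq R) :
  char_poly A = \prod_(x <- s) ('X - x%:P) -> spectrum A = sort <=%R s.
Proof.
move=> cE; have c0 : char_poly A != 0 by rewrite monic_neq0 ?char_poly_monic.
have rP x : (x \in rootsR (char_poly A)) = (x \in s).
  by have := roots_on_rootsR c0 x; rewrite itv_boundlr /= cE root_prod_XsubC => <-.
have us : sorted <%R (rootsR (char_poly A)) by exact: sorted_roots.
rewrite /spectrum; set r := rootsR _ in rP us *.
apply: (@sorted_eq _ <=%R); first exact: le_trans.
- exact: le_anti.
- rewrite sorted_pairwise; last exact: le_trans.
  move: us; rewrite sorted_pairwise; last exact: lt_trans.
  elim: r {rP} => //= a r IH /andP[ar /IH {}IH].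
  rewrite pairwise_cat IH andbT; apply/andP; split.
    apply/allrelP => x y /nseqP[-> _] /flattenP[z /mapP[b br ->]] /nseqP[-> _].
    by apply: ltW; apply: (allP ar).
  elim: (mup _ _) => //= m ->; rewrite andbT; apply/allP => x /nseqP[-> _].
  exact: lexx.
- exact: sort_le_sorted.
have ur : uniq r by apply: (sorted_uniq (@lt_trans _ R) (@ltxx _ R)).
rewrite perm_sym perm_sort; apply/allP => x _ /=; apply/eqP.
rewrite count_flatten -map_comp.
rewrite (eq_map (g := fun y => if y == x then count_mem x s else 0%N)); last first.
  move=> y /=; rewrite count_nseq /= cE; case: eqP => [->|]; last by rewrite mul0n.
  by rewrite mul1n mu_prod_XsubC.
rewrite sumnE big_map; case: (boolP (x \in r)) => xr.
  rewrite (bigD1_seq x) //= eqxx big1 ?addn0 // => y /negPf ->; by [].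
rewrite big_seq big1 => [|y yr]; first by apply/count_memPn; rewrite -rP.
by case: eqP yr xr => // -> ->.
Qed.

Lemma spectrum_sym (R : rcfType) n (A : 'M[R]_n) : A^T = A ->
  [/\ size (spectrum A) = n, sorted <=%R (spectrum A) &
    char_poly A = \prod_(x <- spectrum A) ('X - x%:P)].
Proof.
move=> sA.
have [s cE] : exists s, char_poly A = \prod_(x <- s) ('X - x%:P).
  pose f := real_complex R; pose B := map_mx f A.
  have hB : B \is hermsymmx.
    apply/is_hermitianmxP; rewrite expr0 scale1r; apply/matrixP => i j.
    rewrite !mxE -[in LHS]sA mxE; apply/esym/CrealP.
    by rewrite complex_real.
  have nB := hermitian_normalmx hB; have /orthomx_spectralP BE := nB.
  have rB := hermitian_spectral_diag_real hB.
  set d := spectral_diag B in BE rB.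
  have cB : char_poly B = \prod_i ('X - (d 0 i)%:P).
    have -> : char_poly B = char_poly (diag_mx d).
      set P := spectralmx B in BE; have Pu : P \in unitmx by exact: spectral_unit.
      pose Q := map_mx (@polyC _) P; pose Q' := map_mx (@polyC _) (invmx P).
      have QQ : Q' *m Q = 1%:M by rewrite -map_mxM mulVmx // map_mx1.
      rewrite /char_poly; have -> : char_poly_mx B = Q' *m char_poly_mx (diag_mx d) *m Q.
        rewrite /char_poly_mx {1}BE !map_mxM mulmxBr mulmxBl; congr (_ - _).
        by rewrite scalar_mxC -mulmxA QQ mulmx1.
      by rewrite !det_mulmx mulrAC -det_mulmx QQ det1 mul1r.
    rewrite char_poly_trig ?diag_mx_is_trig //; apply: eq_bigr => i _.
    by rewrite mxE eqxx.
  exists [seq complex.Re (d 0 i) | i <- enum 'I_n].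
  apply: (map_poly_inj f); rewrite map_char_poly cB rmorph_prod big_map big_enum /=.
  apply: eq_bigr => i _; rewrite rmorphB /= map_polyX map_polyC /=.
  congr ('X - _%:P); apply/esym; rewrite /f.
  have := mxOverP rB 0 i; move=> /complex_realP [x ->]; by [].
have n_s : size s = n.
  by have := size_char_poly A; rewrite cE size_prod_XsubC => -[].
rewrite (spectrumE cE); split.
- by rewrite size_sort.
- exact: sort_le_sorted.
by rewrite cE; apply: perm_big; rewrite perm_sym perm_sort.
Qed.

(* Entry 1 is the second smallest eigenvalue. *)
Definition algebraic_connectivity (T : finType) (e : rel T) (R : rcfType) : R :=
  (spectrum (laplacian e R))`_1.

(* Main.v *)
Require Import Defs.
From mathcomp Require Import all_boot all_order all_algebra ring lra.
From mathcomp Require Import constructive_ereal.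

Set Implicit Arguments.
Unset Strict Implicit.
Unset Printing Implicit Defensive.

Import Order.TTheory GRing.Theory Num.Theory.
Local Open Scope ring_scope.

(** Let [f] be an eigenfunction of the Laplacian for [lam], the algebraic
    connectivity, with [\sum_x f x = 0]; such an [f] exists even when [lam] is
    a multiple eigenvalue ([algebraic_connectivity_eigenfunction]).  View
    [f x - f y] as a flow along the edge [xy].  The eigenvalue equation says
    that a set [A] of nodes emits a net flow of [lam * \sum_(x in A) f x]
    ([cut_flow]).  Let [P] be the sum of the positive values of [f], [a] its
    maximum, reached at [u], and [- b] its minimum, reached at [v].

    Cutting the graph at a level of [f] bounds the drop of [f] along any edge
    by [lam * P]; along an edge at [u] the drop is even at most [lam * a].
    Along a path of [k + 2] edges starting at [u], the first edge costs
    [lam * a] and the next [k] edges cost [lam * P] each.  The last edges of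
    the paths from [u] to several nodes [c] are paid for together: where they
    matter they all cross one and the same cut, so that their drops add up to
    at most [lam * P].  This is [total_drop].

    Let [S] be a set of [s] nodes within distance [l = k + 2] of every node.
    For [k > 0], the nodes [c] of [S] with [f c <= 0] are reached from [u], the
    others from [v]; the sum of the two estimates reads
      [L <= lam * (s1 * a + s2 * b + (k * s + 2) * P)],
    where [s1] and [s2] count the two kinds of nodes and [L] is
    [s1 * a + s2 * b + \sum_(c in S) `|f c|].  On the other hand [P] is at most
    the number of positive nodes times [a], and at most the number of the other
    nodes times [b].  As [4 * p * q <= (p + q) ^+ 2], a case analysis
    ([counting_inequality]) yields
    [s * (s1 * a + s2 * b + (k * s + 2) * P) <= L * (n + k * n ^+ 2 / 4)], hence
    [4 * s <= lam * (k * n ^+ 2 + 4 * n)] ([long_range_bound]).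

    For [k = 0] the term [2 * P] is too costly.  There all of [S] is reached
    from [u], which may be assumed to satisfy [\sum_(c in S) f c <= 0] up to
    changing the sign of [f], and the flow leaving [u] and its neighbours is
    computed exactly ([two_step_bound]). *)

(** * An inequality between numbers of nodes *)

(** Below, [s1] and [s2] are the numbers of nodes of [S] where [f] is
    nonpositive, respectively positive; [r1] and [r2] are the same numbers for
    the nodes outside [S]; [w1] and [w2] are the sums of [`|f|] over the two
    parts of [S].  The bound on [P] is split as [r2 * a + w2], and
    [s1 * a + w2] is the share of [L] that depends on [a].  Lowering [a] lowers
    [s1 * a] but raises the [w2] needed to reach [P], so the minimum of this
    share depends on which of [s1] and [r2] is larger. *)
Lemma share_bound_crowded (R : realFieldType) (r s s' a w P : R) :
  0 <= r -> 0 <= s' -> 0 <= s -> w <= s * a -> P <= r * a + w -> r <= s' ->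
  (s' + s) * P <= (s + r) * (s' * a + w).
Proof. nra. Qed.

Lemma share_bound_sparse (R : realFieldType) (r s' a w P : R) :
  0 <= s' -> 0 <= w -> P <= r * a + w -> s' <= r ->
  s' * P <= r * (s' * a + w).
Proof. nra. Qed.

(** Dividing by [p] and [q], this is [1 / p + 1 / q >= 4 / (p + q)]; the product
    form also covers [p = 0] and [q = 0]. *)
Lemma harmonic_bound (R : realFieldType) (p q s A B P : R) :
  0 <= p -> 0 <= q -> 0 < s -> 0 <= A -> 0 <= B -> 0 <= P ->
  s * P <= p * A -> s * P <= q * B -> 4 * s * P <= (p + q) * (A + B).
Proof.
move=> p0 q0 s0 A0 B0 P0 hA hB.
have [->|Pn0] := eqVneq P 0; first nra.
have {Pn0}Pp : 0 < P by rewrite lt_neqAle eq_sym Pn0.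
have Z0 : 0 < s * P by rewrite mulr_gt0.
have pp : 0 < p by rewrite lt_neqAle eq_sym p0 andbT; apply: contraTneq hA => ->; lra.
have qp : 0 < q by rewrite lt_neqAle eq_sym q0 andbT; apply: contraTneq hB => ->; lra.
rewrite -(ler_pM2l (mulr_gt0 pp qp)) -(mulrA 4).
move: (s * P) Z0 hA hB => Z Z0 hA hB.
have h1 : q * (p + q) * Z <= q * (p + q) * (p * A) by apply: ler_wpM2l => //; nra.
have h2 : p * (p + q) * Z <= p * (p + q) * (q * B) by apply: ler_wpM2l => //; nra.
have h3 : 0 <= (p - q) ^+ 2 * Z by rewrite mulr_ge0 ?sqr_ge0 ?ltW.
lra.
Qed.

(** The cases [k = 1] and [k] large of [counting_inequality], when only the
    share of [b] is crowded.  That share alone gives [n ^+ 2 * L >= 4 * p * s * P]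
    with [p = s2 + r2] greater than [s].  Of the term [2 * s * P] it then pays
    one half; the share of [a] pays [s1 * P] and [r * s2 * b] pays [s2 * P],
    where [r = r1 + r2]. *)
Lemma counting_one_crowded (R : realFieldType) (r1 r2 s1 s2 a b w1 w2 P : R) :
  0 <= r1 -> 0 <= s1 -> 0 <= s2 -> 0 <= a -> 0 <= b -> 0 <= w1 -> 0 <= w2 -> 0 <= P ->
  1 <= s1 + s2 ->
  s1 + 1 <= r2 -> r1 <= s2 ->
  P <= (s1 + r1) * b ->
  s1 * P <= r2 * (s1 * a + w2) ->
  (s1 + s2) * P <= (s1 + r1) * (s2 * b + w1) ->
  let s := s1 + s2 in let n := s + (r1 + r2) in
  let L := (s1 * a + w2) + (s2 * b + w1) in
  4 * s ^+ 2 * P <= n ^+ 2 * L /\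
  s * (s1 * a + s2 * b + (s + 2) * P) <= L * (n + n ^+ 2 / 4).
Proof.
move=> r10 s10 s20 a0 b0 w10 w20 P0 sp s1r2 r1s2 bP hA hB s n L.
set A := s1 * a + w2 in hA L *; set B := s2 * b + w1 in hB L *.
have A0 : 0 <= A by rewrite /A addr_ge0 // mulr_ge0.
have B0 : 0 <= B by rewrite /B addr_ge0 // mulr_ge0.
pose p := s2 + r2; pose q := s1 + r1.
have nE : n = p + q by rewrite /n /p /q /s; ring.
have q0 : 0 <= q by rewrite /q; lra.
have ps : s + 1 <= p by rewrite /p /s; lra.
(* 4 p q <= (p + q)^2, and p exceeds s by at least one *)
have n2B : 4 * p * (s * P) <= n ^+ 2 * B.
  have : 4 * (p * q) * B <= n ^+ 2 * B.
    apply: ler_wpM2r => //; rewrite nE; have := sqr_ge0 (p - q); lra.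
  have : p * (s * P) <= p * (q * B) by apply: ler_wpM2l; [rewrite /p; lra | exact: hB].
  lra.
have sP0 : 0 <= s * P by rewrite mulr_ge0 //; rewrite /s; lra.
(* 4 r2 <= n^2 because r2 < n *)
have n2A : 4 * (s1 * P) <= n ^+ 2 * A.
  have : 4 * r2 * A <= n ^+ 2 * A.
    apply: ler_wpM2r => //; have : r2 + 1 <= n by rewrite /n /s; lra.
    have := sqr_ge0 (n - 2); lra.
  lra.
have n2A0 : 0 <= n ^+ 2 * A by rewrite mulr_ge0 ?sqr_ge0.
have psP : (s + 1) * (s * P) <= p * (s * P) by apply: ler_wpM2r.
have sn : s * P <= n * P by apply: ler_wpM2r => //; rewrite /n; lra.
split; first by rewrite /L mulrDr; lra.
have hb : s2 * P <= (r1 + r2) * (s2 * b).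
  have : s2 * P <= s2 * (q * b) by apply: ler_wpM2l.
  have : q * (s2 * b) <= (r1 + r2) * (s2 * b).
    by apply: ler_wpM2r; [rewrite mulr_ge0 | rewrite /q; lra].
  lra.
have ha : 0 <= (r1 + r2) * (s1 * a) by rewrite !mulr_ge0 //; lra.
have hn : 0 <= n * (w1 + w2) by rewrite mulr_ge0 /n /s //; lra.
have -> : L * (n + n ^+ 2 / 4) = s * (s1 * a + s2 * b) + (r1 + r2) * (s1 * a) +
   (r1 + r2) * (s2 * b) + n * (w1 + w2) + n ^+ 2 * A / 4 + n ^+ 2 * B / 4.
  rewrite /L /A /B /n; lra.
have -> : s * (s1 * a + s2 * b + (s + 2) * P) =
  s * (s1 * a + s2 * b) + s * (s * P) + s * P + s1 * P + s2 * P.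
  rewrite /s; ring.
lra.
Qed.

(** With [r = r1 + r2], the two shares are at least [s1 * P / (r - 1)] and
    [s2 * P / (r - 1)] since [r1] and [r2] are at least one, so that
    [s * P <= (r - 1) * L]; what remains is a square. *)
Lemma counting_none_crowded (R : realFieldType) (r1 r2 s1 s2 a b w1 w2 P : R) :
  0 <= s1 -> 0 <= s2 -> 0 <= a -> 0 <= b -> 0 <= w1 -> 0 <= w2 -> 0 <= P ->
  s1 + 1 <= r2 -> s2 + 1 <= r1 ->
  s1 * P <= r2 * (s1 * a + w2) ->
  s2 * P <= r1 * (s2 * b + w1) ->
  let s := s1 + s2 in let n := s + (r1 + r2) in
  let L := (s1 * a + w2) + (s2 * b + w1) in
  4 * s ^+ 2 * P <= n ^+ 2 * L /\
  s * (s1 * a + s2 * b + (s + 2) * P) <= L * (n + n ^+ 2 / 4).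
Proof.
move=> s10 s20 a0 b0 w10 w20 P0 s1r2 s2r1 hA hB s n L.
have s1a : 0 <= s1 * a by rewrite mulr_ge0.
have s2b : 0 <= s2 * b by rewrite mulr_ge0.
set A := s1 * a + w2 in hA L *; set B := s2 * b + w1 in hB L *.
have A0 : 0 <= A by rewrite /A addr_ge0 // mulr_ge0.
have B0 : 0 <= B by rewrite /B addr_ge0 // mulr_ge0.
have L0 : 0 <= L by rewrite addr_ge0.
pose r := r1 + r2.
have sP : s * P <= (r - 1) * L.
  have : r2 * A <= (r - 1) * A by apply: ler_wpM2r => //; rewrite /r; lra.
  have : r1 * B <= (r - 1) * B by apply: ler_wpM2r => //; rewrite /r; lra.
  rewrite /s /L; lra.
have s0 : 0 <= s by rewrite /s; lra.
have ssP : s * (s * P) <= s * ((r - 1) * L) by apply: ler_wpM2l.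
split.
  have : 4 * (s * (r - 1)) * L <= n ^+ 2 * L.
    apply: ler_wpM2r => //; have := sqr_ge0 (s - r); rewrite /n -/r; lra.
  lra.
have hr : s * (s1 * a + s2 * b) + r * L <= n * L.
  have : s * (s1 * a + s2 * b) <= s * L.
    by apply: ler_wpM2l => //; rewrite /L /A /B; lra.
  rewrite /n -/r; lra.
(* (r + n^2 / 4) - (s + 2) (r - 1), with n = s + r *)
have : 0 <= ((s - r + 2) ^+ 2 + 4) / 4 * L.
  by rewrite mulr_ge0 // divr_ge0 // addr_ge0 // sqr_ge0.
move: hr; rewrite /n -/r; lra.
Qed.

(** Integrality matters: a strict inequality between [s1] and [r2], or between
    [s2] and [r1], leaves room for a whole node, and this pays for the term
    [2 * P]. *)
Lemma counting_inequality (R : realFieldType) (r1 r2 s1 s2 : nat) (k a b w1 w2 P : R) :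
  1 <= k -> (0 < s1 + s2)%N -> 0 <= a -> 0 <= b -> 0 <= w1 -> 0 <= w2 -> 0 <= P ->
  w1 <= s1%:R * b -> w2 <= s2%:R * a ->
  P <= r1%:R * b + w1 -> P <= r2%:R * a + w2 ->
  let s := s1%:R + s2%:R in let n := s + (r1%:R + r2%:R) in
  let L := (s1%:R * a + w2) + (s2%:R * b + w1) in
  s * (s1%:R * a + s2%:R * b + (k * s + 2) * P) <= L * (n + k * n ^+ 2 / 4).
Proof.
move=> k1 s_gt0 a0 b0 w10 w20 P0 w1s w2s Pr1 Pr2 /=.
set s := _ + _; set n := s + _; set L := _ + (s2%:R * b + _).
(* linear interpolation: k = 1, and the coefficient of k *)
suff [H1 H2] : 4 * s ^+ 2 * P <= n ^+ 2 * L /\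
    s * (s1%:R * a + s2%:R * b + (s + 2) * P) <= L * (n + n ^+ 2 / 4).
  have : (k - 1) * (4 * s ^+ 2 * P) <= (k - 1) * (n ^+ 2 * L).
    by apply: ler_wpM2l => //; rewrite subr_ge0.
  move: H2; set X := s1%:R * a; set Y := s2%:R * b; lra.
have s_ge1 : 1 <= s by rewrite /s -natrD ler1n.
have Pa : P <= (s2%:R + r2%:R) * a by lra.
have Pb : P <= (s1%:R + r1%:R) * b by lra.
have hA := share_bound_sparse (ler0n R s1) w20 Pr2.
have hB := share_bound_sparse (ler0n R s2) w10 Pr1.
have hA' := share_bound_crowded (ler0n R r2) (ler0n R s1) (ler0n R s2) w2s Pr2.
have hB' := share_bound_crowded (ler0n R r1) (ler0n R s2) (ler0n R s1) w1s Pr1.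
have [s1r2|r2s1] := ltnP s1 r2; have [s2r1|r1s2] := ltnP s2 r1.
- apply: counting_none_crowded; rewrite ?ler0n ?natr1 ?ler_nat //.
    by apply: hA; rewrite ler_nat ltnW.
  by apply: hB; rewrite ler_nat ltnW.
- have := @counting_one_crowded R r1%:R r2%:R s1%:R s2%:R a b w1 w2 P.
  rewrite !ler0n natr1 !ler_nat; apply => //.
  + by apply: hA; rewrite ler_nat ltnW.
  + by rewrite addrC; apply: hB'; rewrite ler_nat.
- have := @counting_one_crowded R r2%:R r1%:R s2%:R s1%:R b a w2 w1 P.
  rewrite !ler0n natr1 !ler_nat.
  rewrite [s2%:R + s1%:R]addrC [r2%:R + r1%:R]addrC [s2%:R * b + s1%:R * a]addrC.
  rewrite [s2%:R * b + w1 + _]addrC; apply => //.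
  + by apply: hB; rewrite ler_nat ltnW.
  + by apply: hA'; rewrite ler_nat.
(* Both sides crowded: n L >= 4 s P leaves a slack of (n - s) s P, which fails
   to cover 2 s P only when at most one node lies outside S.  Then P is at most
   w1 or w2, or both. *)
have {}hA := hA' _ ; have {}hB := hB' _; rewrite !ler_nat in hA hB.
move: (hA r2s1) (hB r1s2) => {}hA {}hB.
set A := s1%:R * a + w2 in hA L *; set B := s2%:R * b + w1 in hB L *.
have A0 : 0 <= A by rewrite /A addr_ge0 // mulr_ge0.
have B0 : 0 <= B by rewrite /B addr_ge0 // mulr_ge0.
have L0 : 0 <= L by rewrite addr_ge0.
have r0 : 0 <= r1%:R + r2%:R :> R by rewrite addr_ge0.
have n0 : 0 <= n by rewrite /n; lra.
have nL : 4 * s * P <= n * L.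
  have -> : n = (s2%:R + r2%:R) + (s1%:R + r1%:R) by rewrite /n /s; ring.
  apply: harmonic_bound => //; rewrite ?addr_ge0 //; first lra.
  by rewrite /s addrC.
have nnL : n * (4 * s * P) <= n * (n * L) by apply: ler_wpM2l.
have sP0 : 0 <= s * P by rewrite mulr_ge0 //; lra.
have sn : s * (s * P) <= n * (s * P) by apply: ler_wpM2r => //; rewrite /n; lra.
split; first lra.
have a1 : 0 <= s1%:R * a by rewrite mulr_ge0.
have b2 : 0 <= s2%:R * b by rewrite mulr_ge0.
have s0 : 0 <= s by lra.
have rX : 0 <= (r1%:R + r2%:R) * (s1%:R * a + s2%:R * b).
  by rewrite mulr_ge0 // addr_ge0.
have -> : L * (n + n ^+ 2 / 4) = s * (s1%:R * a + s2%:R * b) +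
   (r1%:R + r2%:R) * (s1%:R * a + s2%:R * b) + n * (w1 + w2) + n ^+ 2 * L / 4.
  rewrite /L /A /B /n; lra.
suff : 2 * (s * P) <= (r1%:R + r2%:R) * (s * P) + n * (w1 + w2).
  have -> : (r1%:R + r2%:R) * (s * P) = n * (s * P) - s * (s * P).
    by rewrite /n; ring.
  lra.
have w0 : 0 <= w1 + w2 by rewrite addr_ge0.
have snw : s * (w1 + w2) <= n * (w1 + w2) by apply: ler_wpM2r => //; rewrite /n; lra.
have [r_ge2|] := leqP 2 (r1 + r2).
  have : 2 * (s * P) <= (r1 + r2)%:R * (s * P) by apply: ler_wpM2r => //; rewrite ler_nat.
  have : 0 <= n * (w1 + w2) by rewrite mulr_ge0.
  rewrite natrD; lra.
rewrite ltnS; case: (r1) (r2) Pr1 Pr2 => [|[|//]] [|[|//]] // Pr1 Pr2 _.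
- have : s * (2 * P) <= s * (w1 + w2) by apply: ler_wpM2l => //; lra.
  lra.
- have : s * P <= s * (w1 + w2) by apply: ler_wpM2l => //; lra.
  lra.
- have : s * P <= s * (w1 + w2) by apply: ler_wpM2l => //; lra.
  lra.
Qed.

(** * Balls and eccentricity *)

Section Balls.
Variables (T : finType) (e : rel T).

Fixpoint ball (u : T) (k : nat) : {set T} :=
  if k is j.+1 then
    [set x | (x \in ball u j) || [exists y in ball u j, e x y]]
  else [set u].

Lemma ball_sub u j k : (j <= k)%N -> ball u j \subset ball u k.
Proof.
elim: k => [|k IH]; first by rewrite leqn0 => /eqP->.
rewrite leq_eqVlt => /orP[/eqP->//|/IH/subsetP jk].
by apply/subsetP => x /jk xk; rewrite inE xk.
Qed.

Lemma path_in_ball x p : path e x p -> x \in ball (last x p) (size p).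
Proof.
elim: p x => [|y p IH] x /=; first by rewrite inE.
move=> /andP[xy /IH yp]; rewrite inE; apply/orP; right.
by apply/existsP; exists y; rewrite yp.
Qed.

Lemma eccentricity_ball (R : rcfType) x l u :
  (eccentricity e R x <= l%:R%:E)%E -> x \in ball u l.
Proof.
move=> /bigmax_leP[_ /(_ u isT)]; rewrite leNgt => /negP d.
have [|none] := boolP [exists k : 'I_#|T|, has_path_of_length e k x u && (k <= l)%N].
  move=> /existsP[k /andP[/existsP[p /and3P[ep /eqP <- _]] kl]].
  by apply: (subsetP (ball_sub _ kl)); rewrite -{2}(size_tuple p) path_in_ball.
exfalso; apply: d; apply/bigmin_gtP; split; first exact: ltry.
move=> k kP; rewrite lte_fin ltr_nat ltnNge; apply/negP => kl.
by move/existsP: none => []; exists k; rewrite kP.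
Qed.

End Balls.

(** * Eigenfunctions as flows *)

Lemma exists_max (T : finType) (R : realFieldType) (f : T -> R) (x0 : T) :
  exists u, forall x, f x <= f u.
Proof.
have [u _ umax] := Order.TotalTheory.arg_maxP f (erefl true : predT x0).
by exists u => x; apply: umax.
Qed.

Section Eigenfunctions.
Variables (T : finType) (e : rel T) (R : realFieldType).
Hypothesis e_sym : symmetric e.
Implicit Types (f : T -> R) (lam : R) (A : {set T}).

Definition eigenfunction lam f :=
  forall x, \sum_(y | e x y) (f x - f y) = lam * f x.

Lemma eigenfunctionN lam f :
  eigenfunction lam f -> eigenfunction lam (fun x => - f x).
Proof.
move=> fL x; rewrite mulrN -fL -sumrN; apply: eq_bigr => y _; ring.
Qed.

(** The flow is antisymmetric, so that the edges inside [A] cancel. *)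
Lemma cut_flow lam f A : eigenfunction lam f ->
  \sum_(x in A) \sum_(y | e x y && (y \notin A)) (f x - f y) =
  lam * \sum_(x in A) f x.
Proof.
move=> fL; rewrite mulr_sumr.
rewrite (eq_bigr _ (fun x _ => esym (fL x))).
under [RHS]eq_bigr => x _ do rewrite (bigID (mem A)) /=.
rewrite big_split /=; set I := (X in _ = X + _); suff -> : I = 0 by rewrite add0r.
have : I = - I.
  rewrite {1}/I (exchange_big_dep (mem A)) /=; last by move=> x y _ /andP[].
  rewrite -sumrN; apply: eq_bigr => y yA; rewrite -sumrN.
  rewrite (eq_bigl (fun x => e y x && (x \in A))).
    by apply: eq_bigr => x _; rewrite opprB.
  by move=> x /=; rewrite yA andbT e_sym andbC.
lra.
Qed.

Definition pos_mass f := \sum_x Num.max (f x) 0.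

Lemma sum_le_pos_mass f A : \sum_(x in A) f x <= pos_mass f.
Proof.
rewrite /pos_mass [leRHS](bigID (mem A)) /=; rewrite -[leLHS]addr0 lerD //.
  by apply: ler_sum => x _; rewrite le_max lexx.
by apply: sumr_ge0 => x _; rewrite le_max lexx orbT.
Qed.

Lemma pos_mass_ge0 f : 0 <= pos_mass f.
Proof. by apply: sumr_ge0 => x _; rewrite le_max lexx orbT. Qed.

Lemma pos_massN f : \sum_x f x = 0 -> pos_mass (fun x => - f x) = pos_mass f.
Proof.
move=> f0; apply/eqP; rewrite -subr_eq0 /pos_mass -sumrB -oppr_eq0 -sumrN.
rewrite -[X in _ == X]f0; apply/eqP; apply: eq_bigr => x _.
by rewrite /Num.max; case: ifP; case: ifP; lra.
Qed.

(** At a positive maximum of [f] every edge carries a nonnegative flow, and [- f]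
    is an eigenfunction as well. *)
Lemma eigenvalue_ge0 lam f x : eigenfunction lam f -> f x != 0 -> 0 <= lam.
Proof.
move=> fL fx; wlog fx0 : f fL fx / 0 < f x.
  move=> wl; have [fp|fn] := ltP 0 (f x); first exact: (wl f).
  apply: (wl _ (eigenfunctionN fL)); rewrite ?oppr_eq0 // oppr_gt0.
  by rewrite lt_neqAle fx.
have [u umax] := exists_max f x.
have fu : 0 < f u by apply: lt_le_trans fx0 (umax x).
rewrite -(pmulr_lge0 _ fu) -fL; apply: sumr_ge0 => y _.
by rewrite subr_ge0 umax.
Qed.

Lemma max_gt0 (f : T -> R) x0 u : \sum_x f x = 0 -> f x0 != 0 ->
  (forall x, f x <= f u) -> 0 < f u.
Proof.
move=> f0 fx umax; rewrite ltNge; apply/negP => fu.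
have fle x : f x <= 0 := le_trans (umax x) fu.
have : \sum_x - f x == 0 by rewrite sumrN f0 oppr0.
rewrite psumr_eq0; last by move=> x _; rewrite oppr_ge0.
by move=> /allP/(_ x0 (mem_index_enum x0)); rewrite oppr_eq0 (negPf fx).
Qed.

Section Maximum.
Variables (lam : R) (f : T -> R) (u : T).
Hypotheses (fL : eigenfunction lam f) (lam0 : 0 <= lam)
  (umax : forall x, f x <= f u).

(** When all flows across the cut go the same way, one of them is at most the
    total. *)
Lemma cut_term_le A x y :
  (forall x y, x \in A -> y \notin A -> f y <= f x) ->
  x \in A -> y \notin A -> e x y -> f x - f y <= lam * pos_mass f.
Proof.
move=> Adown xA yA exy.
apply: (@le_trans _ _ (lam * \sum_(x in A) f x)); last first.
  by rewrite ler_wpM2l // sum_le_pos_mass.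
rewrite -(cut_flow _ fL) (bigD1 x) //= (bigD1 y) /=; last by rewrite exy.
rewrite -addrA lerDl addr_ge0 //; apply: sumr_ge0 => z.
  by move=> /andP[/andP[_ zA] _]; rewrite subr_ge0 Adown.
move=> /andP[zA _]; apply: sumr_ge0 => t /andP[_ tA].
by rewrite subr_ge0 Adown.
Qed.

Lemma edge_drop x y : e x y -> f x - f y <= lam * pos_mass f.
Proof.
move=> exy; have [xy|yx] := leP (f x) (f y).
  apply: (@le_trans _ _ 0); first by rewrite subr_le0.
  by rewrite mulr_ge0 // pos_mass_ge0.
apply: (@cut_term_le [set z | f y < f z]) exy; rewrite ?inE ?ltxx //.
by move=> z t; rewrite !inE -leNgt => zy ty; apply: le_trans ty (ltW zy).
Qed.

Lemma max_edge_drop x : e u x -> f u - f x <= lam * f u.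
Proof.
move=> ux; rewrite -fL (bigD1 x) //= lerDl; apply: sumr_ge0 => y _.
by rewrite subr_ge0.
Qed.

Lemma ball_drop j x : 0 <= f u -> x \in ball e u j.+1 ->
  f u - f x <= lam * (f u + j%:R * pos_mass f).
Proof.
move=> fu0; have P0 := pos_mass_ge0 f.
have G0 i : 0 <= lam * (f u + i%:R * pos_mass f).
  by rewrite mulr_ge0 // addr_ge0 // mulr_ge0.
elim: j x => [|j IH] x; rewrite inE => /orP[].
- by rewrite inE => /eqP->; rewrite subrr.
- move=> /existsP[y /andP[]]; rewrite inE => /eqP->; rewrite e_sym => /max_edge_drop.
  by rewrite mul0r addr0.
- move/IH => /le_trans; apply; rewrite ler_wpM2l // lerD2l ler_wpM2r //.
  by rewrite ler_nat.
move=> /existsP[y /andP[/IH yj]]; rewrite e_sym => /edge_drop.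
rewrite -natr1; lra.
Qed.

(** Let [G] bound, up to the factor [lam], the drop from [u] to any node of the
    ball of radius [k + 1].  The nodes of [A] further below than that lie in
    [D]; each is joined to a node of the smaller ball, which lies outside [D].
    The excesses over [lam * G] are thus drops along distinct edges of the cut
    at [D], and their sum is at most the flow into [D]. *)
Lemma total_drop k A : \sum_x f x = 0 -> 0 <= f u -> A \subset ball e u k.+2 ->
  \sum_(c in A) (f u - f c) <=
  lam * (#|A|%:R * (f u + k%:R * pos_mass f) + pos_mass f).
Proof.
move=> f0 fu0 /subsetP Ak; set G := f u + _.
pose D := [set z | f z < f u - lam * G].
have -> : \sum_(c in A) (f u - f c) =
   lam * (#|A|%:R * G) + \sum_(c in A) (f u - lam * G - f c).
  by rewrite !sumrB !sumr_const -(mulr_natl (f u)) -(mulr_natl (lam * G)); ring.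
rewrite [leRHS]mulrDr lerD2l.
apply: (@le_trans _ _ (\sum_(y in D) \sum_(x | e y x && (x \notin D)) (f x - f y))).
  rewrite (bigID (mem D)) /= -[leRHS]addr0 lerD //; last first.
    by apply: sumr_le0 => c /andP[_]; rewrite inE -leNgt subr_le0.
  rewrite [leRHS](bigID (mem A)) /= -[leLHS]addr0 lerD //; last first.
    apply: sumr_ge0 => y /andP[yD _]; apply: sumr_ge0 => x /andP[_].
    by move: yD; rewrite !inE -leNgt subr_ge0 => yD /(le_trans (ltW yD)).
  rewrite (eq_bigl (fun y => (y \in D) && (y \in A))); last by move=> y; rewrite andbC.
  apply: ler_sum => c /andP[cD /Ak].
  rewrite inE => /orP[/(ball_drop fu0)|].
    by move: cD; rewrite inE -/G => ? ?; lra.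
  move=> /existsP[x /andP[/(ball_drop fu0)]]; rewrite -/G => xG cx.
  have xD : x \notin D by rewrite inE -leNgt; lra.
  rewrite (bigD1 x) /=; last by rewrite cx.
  apply: (@le_trans _ _ (f x - f c)); first lra.
  rewrite lerDl; apply: sumr_ge0 => y /andP[/andP[_]].
  by move: cD; rewrite !inE -leNgt subr_ge0 => yD /(le_trans (ltW yD)).
have := cut_flow D (eigenfunctionN fL); rewrite sumrN.
under eq_bigr => x _ do under eq_bigr => y _ do rewrite opprK addrC.
move=> ->; rewrite ler_wpM2l // -sumrN.
by rewrite -(pos_massN f0) sum_le_pos_mass.
Qed.

End Maximum.

Lemma pos_mass_split (f : T -> R) (S : {set T}) a : (forall x, f x <= a) ->
  pos_mass f <= #|[set x | (0 < f x) && (x \notin S)]|%:R * a +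
                \sum_(x in S | 0 < f x) f x.
Proof.
move=> fa; rewrite /pos_mass (bigID (fun x => 0 < f x)) /= [X in _ + X]big1 ?addr0.
  rewrite (bigID (mem S)) /= addrC lerD //.
    rewrite -sum1_card natr_sum mulr_suml (eq_bigl (fun x => x \in [set x | (0 < f x) && (x \notin S)])).
      by apply: ler_sum => x; rewrite inE mul1r => /andP[x0 _]; rewrite max_l // ltW.
    by move=> x; rewrite inE.
  rewrite (eq_bigl _ _ (fun x => andbC _ _)) ler_sum // => x /andP[_ x0].
  by rewrite max_l // ltW.
by move=> x; rewrite -leNgt => x0; rewrite max_r.
Qed.

End Eigenfunctions.

(** * Sets within distance l of every node, for l at least three *)

(** The nodes of [S] where [f] is nonpositive are reached from a maximum of [f],
    the others from a minimum. *)
Lemma long_range_bound (T : finType) (e : rel T) (R : realFieldType)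
    lam (f : T -> R) (S : {set T}) k x0 :
  symmetric e -> eigenfunction e lam f -> \sum_x f x = 0 -> f x0 != 0 ->
  (forall u, S \subset ball e u k.+3) ->
  4 * #|S|%:R <= lam * (k.+1%:R * #|T|%:R ^+ 2 + 4 * #|T|%:R).
Proof.
move=> e_sym fL f0 fx Sball.
have lam0 := eigenvalue_ge0 fL fx.
have [-> | Sn0] := posnP #|S|.
  by rewrite mulr0 mulr_ge0 // addr_ge0 // mulr_ge0 // exprn_ge0.
have [u umax] := exists_max f x0; have [v vmax] := exists_max (fun x => - f x) x0.
have nf0 : \sum_x - f x = 0 by rewrite sumrN f0 oppr0.
have a0 := max_gt0 f0 fx umax.
have b0 : 0 < - f v by apply: max_gt0 nf0 _ vmax; rewrite oppr_eq0; exact: fx.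
pose S2 := S :&: [set x | 0 < f x]; pose S1 := S :\: [set x | 0 < f x].
have S1sub : S1 \subset ball e u k.+3 by apply: subset_trans (subsetDl _ _) (Sball u).
have S2sub : S2 \subset ball e v k.+3 by apply: subset_trans (subsetIl _ _) (Sball v).
have D1 := total_drop e_sym fL lam0 umax f0 (ltW a0) S1sub.
have D2 := total_drop e_sym (eigenfunctionN fL) lam0 vmax nf0 (ltW b0) S2sub.
rewrite (pos_massN f0) in D2; set P := pos_mass f in D1 D2.
pose w1 := \sum_(x in S1) - f x; pose w2 := \sum_(x in S2) f x.
pose R2 := [set x | (0 < f x) && (x \notin S)].
pose R1 := ~: S :\: [set x | 0 < f x].
have P0 : 0 <= P := pos_mass_ge0 f.
have S2P x : x \in S2 -> 0 < f x by rewrite !inE => /andP[].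
have S1P x : x \in S1 -> f x <= 0 by rewrite !inE -leNgt => /andP[].
have w20 : 0 <= w2 by apply: sumr_ge0 => x /S2P /ltW.
have w10 : 0 <= w1 by apply: sumr_ge0 => x /S1P; rewrite oppr_ge0.
have w2a : w2 <= #|S2|%:R * f u.
  by rewrite mulr_natl -sumr_const; apply: ler_sum.
have w1b : w1 <= #|S1|%:R * - f v.
  by rewrite mulr_natl -sumr_const; apply: ler_sum.
have Pr2 : P <= #|R2|%:R * f u + w2.
  apply: le_trans (pos_mass_split S umax) _; rewrite lerD2l le_eqVlt; apply/orP; left.
  by apply/eqP; apply: eq_bigl => x; rewrite !inE.
have Pr1 : P <= #|R1|%:R * - f v + w1.
  rewrite /P -(pos_massN f0); apply: le_trans (pos_mass_split S vmax) _.
  apply: lerD.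
    apply: ler_wpM2r; first exact: ltW.
    rewrite ler_nat; apply: subset_leq_card; apply/subsetP => x.
    by rewrite !inE oppr_gt0 -leNgt => /andP[/ltW -> ->].
  rewrite /w1 [leRHS](bigID (fun x => f x < 0)) /= -[leLHS]addr0 lerD //.
    rewrite le_eqVlt; apply/orP; left; apply/eqP; apply: eq_bigl => x.
    by rewrite !inE oppr_gt0 -leNgt; case: (ltgtP (f x) 0); rewrite ?andbF ?andbT.
  by apply: sumr_ge0 => x /andP[/S1P]; rewrite oppr_ge0.
have cS : (#|S1| + #|S2| = #|S|)%N by rewrite addnC cardsID.
have cR : (#|R1| + #|R2| = #|~: S|)%N.
  rewrite addnC -(cardsID [set x | 0 < f x] (~: S)); congr (_ + _)%N.
  by apply: eq_card => x; rewrite !inE andbC.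
have cn : (#|S| + #|~: S| = #|T|)%N by rewrite cardsC.
have k1 : 1 <= k.+1%:R :> R by rewrite ler1n.
have sn0 : (0 < #|S1| + #|S2|)%N by rewrite cS.
have := counting_inequality k1 sn0 (ltW a0) (ltW b0) w10 w20 P0 w1b w2a Pr1 Pr2.
move=> /=; rewrite -!natrD cS cR cn.
set L := _ + (_ + w1); set n := #|T|%:R; set K := k.+1%:R => count.
have LE : L = \sum_(c in S1) (f u - f c) + \sum_(c in S2) (- f v - - f c).
  rewrite !sumrB !sumr_const -(mulr_natl (f u)) -(mulr_natl (- f v)).
  by rewrite /L /w1 /w2 !sumrN; ring.
have s0 : 0 < #|S|%:R :> R by rewrite ltr0n.
have sE : #|S|%:R = #|S1|%:R + #|S2|%:R :> R by rewrite -cS natrD.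
have L0 : 0 < L.
  have -> : L = (#|S1|%:R * f u + #|S2|%:R * - f v) + (w1 + w2) by rewrite /L; ring.
  apply: ltr_wpDr; first exact: addr_ge0.
  move: Sn0; rewrite -cS addn_gt0 => /orP[c0|c0].
    by rewrite ltr_pwDl ?mulr_gt0 ?ltr0n // mulr_ge0 // ltW.
  by rewrite ltr_wpDl ?mulr_gt0 ?ltr0n // mulr_ge0 // ltW.
have Lle : L <= lam * (#|S1|%:R * f u + #|S2|%:R * - f v + (K * #|S|%:R + 2) * P).
  rewrite LE; apply: le_trans (lerD D1 D2) _; rewrite sE -/K; lra.
have : #|S|%:R * L <= lam * (L * (n + K * n ^+ 2 / 4)).
  have := ler_wpM2l lam0 count; have := ler_wpM2l (ltW s0) Lle; lra.
have -> : lam * (L * (n + K * n ^+ 2 / 4)) = (lam * (n + K * n ^+ 2 / 4)) * L by ring.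
rewrite ler_pM2r //; lra.
Qed.

(** * Sets within distance two of every node *)

(** Put [g x = f u - f x >= 0], let [W] be the set of neighbours of [u], and [A]
    that of [u] and its neighbours.  The sum of [g] over [W] is [lam * f u], and
    the flow out of [A] gives the sum of [g] over the far ends of the edges
    leaving [A], a sum that counts every node of [S] outside [A] at least once.
    The bound follows if each [w] in [W] misses some node outside [A].
    Otherwise a single [w] is adjacent to all nodes outside [A], and its own
    eigenvalue equation bounds [\sum_x g x], which is [n * f u]; this leaves
    [(1 - lam) * (n - lam) <= 0], hence [1 <= lam]. *)
Lemma max_two_step_bound (T : finType) (e : rel T) (R : realFieldType)
    lam (f : T -> R) (S : {set T}) u :
  symmetric e -> eigenfunction e lam f -> 0 <= lam -> 0 < f u -> (forall x, f x <= f u) ->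
  irreflexive e -> \sum_x f x = 0 -> \sum_(x in S) f x <= 0 ->
  S \subset ball e u 2 ->
  #|S|%:R <= lam * #|T|%:R.
Proof.
move=> e_sym fL lam0 a0 umax e_irr f0 Sf /subsetP Sball.
have sn : #|S|%:R <= #|T|%:R :> R by rewrite ler_nat max_card.
have [lam1|lam1] := leP 1 lam; first by apply: le_trans sn _; rewrite ler_peMl.
set a := f u in a0 *; set n := #|T|%:R in sn *.
pose g x := a - f x.
have g0 x : 0 <= g x by rewrite subr_ge0 umax.
pose W := [set x | e u x].
have uW : u \notin W by rewrite inE e_irr.
have gW : \sum_(x in W) g x = lam * a.
  by rewrite -fL; apply: eq_bigl => x; rewrite inE.
pose A := u |: W.
pose d x := #|[set y | e x y & y \notin A]|.
have cA : #|A| = #|W|.+1 by rewrite cardsU1 uW.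
have nE : n = 1 + #|W|%:R + #|~: A|%:R.
  by rewrite /n -(cardsC A) natrD cA -natr1; ring.
have dA x : (d x <= #|~: A|)%N.
  by apply: subset_leq_card; apply/subsetP => y; rewrite !inE => /andP[].
have sumA : \sum_(x in A) f x = a * (1 + #|W|%:R) - lam * a.
  rewrite big_setU1 //= -/a -gW /g sumrB sumr_const -mulr_natl; ring.
have out : \sum_(x in W) \sum_(y | e x y && (y \notin A)) g y =
    lam * (a * (1 + #|W|%:R) - lam * a) + \sum_(x in W) (d x)%:R * g x.
  rewrite -sumA -(cut_flow e_sym A fL) big_setU1 //= [X in X + _ + _]big1 ?add0r.
    rewrite -big_split /=; apply: eq_bigr => x _.
    rewrite /d -sum1_card natr_sum mulr_suml.
    rewrite [X in _ = _ + X](eq_bigl (fun y => e x y && (y \notin A))).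
      by rewrite -big_split /=; apply: eq_bigr => y _; rewrite /g; ring.
    by move=> y; rewrite !inE.
  by move=> y; rewrite !inE => /andP[->]; rewrite orbT.
have [/existsP[w /andP[wW /eqP dw]]|none] := boolP [exists w in W, d w == #|~: A|].
  have wA y : y \notin A -> e w y.
    move=> yA; have : [set y | e w y & y \notin A] = ~: A.
      apply/eqP; rewrite eqEcard -/(d w) dw leqnn andbT.
      by apply/subsetP => z; rewrite !inE => /andP[].
    by move/setP/(_ y); rewrite !inE in yA *; rewrite yA andbT.
  have ga : g w <= lam * a.
    by rewrite -gW (bigD1 w) //= lerDl sumr_ge0.
  have gA : \sum_(y in ~: A) g y <= \sum_(y | e w y) g y.
    rewrite [leRHS](bigID (mem A)) /= addrC -[leLHS]addr0 lerD ?sumr_ge0 //.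
    rewrite le_eqVlt; apply/orP; left; apply/eqP; apply: eq_bigl => y.
    by rewrite inE; case: (boolP (y \in A)); rewrite ?andbF ?andbT // => /wA.
  have deg : #|[set y | e w y]|%:R <= n - 1.
    rewrite lerBrDr natr1 ler_nat (leq_trans _ (max_card [set: T])) //.
    rewrite (cardsD1 w [set: T]) inE add1n ltnS; apply: subset_leq_card.
    apply/subsetP => y; rewrite !inE andbT => wy.
    by apply: contraTneq wy => ->; rewrite e_irr.
  have gw : \sum_(y | e w y) g y = lam * (a - g w) + #|[set y | e w y]|%:R * g w.
    have -> : a - g w = f w by rewrite /g; ring.
    rewrite -fL -sum1_card natr_sum mulr_suml.
    rewrite [X in _ + X](eq_bigl (e w)); last by move=> y; rewrite inE.
    by rewrite -big_split /=; apply: eq_bigr => y _; rewrite /g; ring.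
  have gT : n * a = \sum_(y in A) g y + \sum_(y in ~: A) g y.
    rewrite [X in _ = _ + X](eq_bigl (fun y => y \notin A)); last by move=> y; rewrite inE.
    transitivity (\sum_x g x); last by rewrite (bigID (mem A)).
    by rewrite /g sumrB f0 subr0 sumr_const mulr_natl.
  have n2 : 2 <= n.
    rewrite nE; have : (0 < #|W|)%N by rewrite (cardD1 w) wW.
    by rewrite -(ler_nat R) => ?; have := ler0n R #|~: A|; lra.
  rewrite big_setU1 //= {1}/g -/a subrr add0r gW in gT.
  have h1 : #|[set y | e w y]|%:R * g w <= (n - 1) * g w by apply: ler_wpM2r.
  have h2 : (n - 1 - lam) * g w <= (n - 1 - lam) * (lam * a).
    by apply: ler_wpM2l => //; lra.
  have h3 : (1 - lam) * (n - lam) * a <= 0 by lra.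
  have : 0 < (1 - lam) * (n - lam) * a by rewrite !mulr_gt0 //; lra.
  lra.
have dW : \sum_(x in W) (d x)%:R * g x <= (#|~: A|%:R - 1) * (lam * a).
  rewrite -gW mulr_sumr; apply: ler_sum => x xW; apply: ler_wpM2r => //.
  rewrite lerBrDr natr1 ler_nat ltn_neqAle dA andbT.
  by apply: contraNneq none => dx; apply/existsP; exists x; rewrite xW dx eqxx.
have far : \sum_(y in S :\: A) g y <=
    \sum_(x in W) \sum_(y | e x y && (y \notin A)) g y.
  rewrite (exchange_big_dep (fun y => y \notin A)) /=; last by move=> x y _ /andP[].
  rewrite [leRHS](bigID (mem S)) /= -[leLHS]addr0 lerD //; last first.
    by apply: sumr_ge0 => y _; apply: sumr_ge0 => x _.
  rewrite (eq_bigl (fun y => (y \notin A) && (y \in S))); last by move=> y; rewrite !inE.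
  apply: ler_sum => c /andP[cA' /Sball].
  have : c \notin A by [].
  rewrite !inE negb_or => /andP[cu uc].
  rewrite (negPf cu) /= => /orP[|].
    by move=> /existsP[y /andP[]]; rewrite inE => /eqP->; rewrite e_sym (negPf uc).
  move=> /existsP[y /andP[]]; rewrite !inE => /orP[/eqP->|].
    by rewrite e_sym (negPf uc).
  move=> /existsP[z /andP[]]; rewrite inE => /eqP->; rewrite e_sym => uy cy.
  rewrite (bigD1 y) /=; last by rewrite [y \in W]inE uy e_sym cy uc.
  by rewrite lerDl sumr_ge0.
have near : \sum_(y in S :&: A) g y <= lam * a.
  apply: (@le_trans _ _ (\sum_(y in A) g y)).
    rewrite [leRHS](big_setID S) /= setIC lerDl sumr_ge0 //.
  by rewrite big_setU1 //= {1}/g -/a subrr add0r gW.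
have gS : #|S|%:R * a <= \sum_(y in S) g y.
  by rewrite /g sumrB sumr_const -mulr_natl; lra.
rewrite (big_setID A) /= in gS.
have l2 : 0 <= lam * lam * a by rewrite !mulr_ge0 // ltW.
rewrite -(ler_pM2r a0) nE; lra.
Qed.

Lemma two_step_bound (T : finType) (e : rel T) (R : realFieldType) lam
    (f : T -> R) (S : {set T}) x0 :
  symmetric e -> irreflexive e ->
  eigenfunction e lam f -> \sum_x f x = 0 -> f x0 != 0 ->
  (forall u, S \subset ball e u 2) ->
  #|S|%:R <= lam * #|T|%:R.
Proof.
move=> e_sym e_irr fL f0 fx Sball.
wlog Sf : f fL f0 fx / \sum_(x in S) f x <= 0.
  move=> wl; have [Sf|/ltW Sf] := leP (\sum_(x in S) f x) 0; first exact: (wl f).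
  apply: (wl _ (eigenfunctionN fL)); rewrite ?sumrN ?f0 ?oppr0 ?oppr_eq0 //.
  by rewrite oppr_le0.
have [u umax] := exists_max f x0.
exact: (max_two_step_bound e_sym fL (eigenvalue_ge0 fL fx) (max_gt0 f0 fx umax)).
Qed.

(** * The eigenfunction of the algebraic connectivity *)

Lemma sum_enum_val (V : nmodType) (T : finType) (F : T -> V) :
  \sum_x F x = \sum_(j < #|T|) F (enum_val j).
Proof.
by rewrite (reindex (@enum_val T T)) //=; exists enum_rank => y _;
  rewrite ?enum_valK ?enum_rankK.
Qed.

Lemma laplacian_action (T : finType) (e : rel T) (R : rcfType)
    (g : 'rV[R]_#|T|) (x : T) : symmetric e ->
  (g *m laplacian e R) 0 (enum_rank x) =
  \sum_(y | e x y) (g 0 (enum_rank x) - g 0 (enum_rank y)).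
Proof.
move=> e_sym; rewrite /laplacian mulmxBr mxE /degree_mx mul_mx_diag !mxE.
rewrite sumrB; congr (_ - _).
  rewrite mulr_sumr [RHS]big_mkcond /= [RHS]sum_enum_val.
  by apply: eq_bigr => j _; rewrite mxE enum_rankK; case: (e _ _); rewrite ?mulr1 ?mulr0.
rewrite [RHS]big_mkcond /= [RHS]sum_enum_val.
apply: eq_bigr => j _; rewrite mxE enum_rankK enum_valK e_sym.
by case: (e _ _); rewrite ?mulr1 ?mulr0.
Qed.

(** The matrix obtained from ['X - A] by adding all columns to column [i0] and
    then dividing this column by ['X], when the rows of [A] have sum zero. *)
Definition deflated_mx (R : nzRingType) n (A : 'M[R]_n) (i0 : 'I_n) :
    'M[{poly R}]_n :=
  \matrix_(i, j) if j == i0 then 1 else char_poly_mx A i j.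

(** As [i0] is the first index, the matrix [C] of the column operation is
    triangular, with ones on its diagonal. *)
Lemma char_poly_deflate (R : comUnitRingType) n (A : 'M[R]_n) (i0 : 'I_n) :
  i0 = 0%N :> nat -> A *m const_mx 1 = 0 :> 'cV_n ->
  char_poly A = \det (deflated_mx A i0) * 'X.
Proof.
move=> i00 A1.
pose C : 'M[{poly R}]_n := \matrix_(i, j) ((j == i0) || (i == j))%:R.
pose d : 'rV[{poly R}]_n := \row_j if j == i0 then 'X else 1.
have detC : \det C = 1.
  rewrite det_trig; first by apply: big1 => i _; rewrite mxE eqxx orbT.
  apply/is_trig_mxP => i j ij; rewrite mxE.
  have -> : (j == i0) = false.
    by apply: contraTF ij => /eqP->; rewrite i00.
  by have -> : (i == j) = false by apply: contraTF ij => /eqP->; rewrite ltnn.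
have detd : \det (diag_mx d) = 'X.
  rewrite det_diag (bigD1 i0) //= mxE eqxx big1 ?mulr1 // => i ii0.
  by rewrite mxE (negPf ii0).
rewrite -[LHS]mulr1 -detC -detd -!det_mulmx; congr (\det _).
apply/matrixP => i j; rewrite mul_mx_diag !mxE.
have [->|ji0] := eqVneq j i0; last first.
  rewrite (bigD1 j) //= big1 => [|k kj]; rewrite !mxE (negPf ji0) /=.
    by rewrite eqxx addr0.
  by rewrite (negPf kj) mulr0.
rewrite mul1r.
rewrite (eq_bigr (fun k => 'X *+ (i == k) - (A i k)%:P)); last first.
  by move=> k _; rewrite !mxE eqxx mulr1.
rewrite sumrB (bigD1 i) //= eqxx big1 => [|k ki]; last by rewrite eq_sym (negPf ki).
have /matrixP/(_ i 0) := A1; rewrite !mxE => Ai.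
rewrite -rmorph_sum /= (_ : \sum_k A i k = 0) ?addr0 ?subr0 //.
by rewrite -[RHS]Ai; apply: eq_bigr => k _; rewrite mxE mulr1.
Qed.

(** Column [i0] of the deflated matrix is constant, so that a vector of its left
    kernel has sum zero.  The other columns give all coordinates of the
    eigenvector equation but one, and the last one follows since both sides of
    the equation have sum zero. *)
Lemma deflated_eigenvector (F : fieldType) n (A : 'M[F]_n) (i0 : 'I_n) (y : F) :
  A *m const_mx 1 = 0 :> 'cV_n -> root (\det (deflated_mx A i0)) y ->
  exists g : 'rV[F]_n, [/\ g != 0, g *m A = y *: g & \sum_i g 0 i = 0].
Proof.
move=> A1; rewrite /root -horner_evalE -det_map_mx => /det0P[g gn0 gM].
have gcol j : \sum_i g 0 i * (if j == i0 then 1 else (y *+ (i == j) - A i j)) = 0.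
  move/rowP/(_ j): gM; rewrite !mxE; apply: etrans; apply: eq_bigr => i _; rewrite !mxE.
  by case: (j == i0); rewrite /= horner_evalE ?hornerC // hornerD hornerN hornerMn hornerX hornerC.
have gsum : \sum_i g 0 i = 0.
  by rewrite -[RHS](gcol i0); apply: eq_bigr => i _; rewrite eqxx mulr1.
have gAj j : j != i0 -> (g *m A) 0 j = y * g 0 j.
  move=> ji0; have := gcol j; rewrite (negPf ji0).
  under eq_bigr => i _ do rewrite mulrBr.
  rewrite sumrB mxE (bigD1 j) //= eqxx big1 => [/eqP|i ij]; last by rewrite (negPf ij) mulr0.
  by rewrite addr0 subr_eq0 mulr1n mulrC => /eqP.
exists g; split=> //; apply/rowP => j; rewrite [RHS]mxE.
have [->|] := eqVneq j i0; last exact: gAj.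
have : \sum_j (g *m A) 0 j = \sum_j y * g 0 j.
  rewrite -mulr_sumr gsum mulr0; transitivity ((g *m (A *m const_mx 1 : 'cV_n)) 0 0).
    by rewrite mulmxA [RHS]mxE; apply: eq_bigr => k _; rewrite [const_mx _ _ _]mxE mulr1.
  by rewrite A1 mulmx0 mxE.
rewrite (bigD1 i0) // [RHS](bigD1 i0) //=.
by rewrite (eq_bigr _ gAj) => /addIr.
Qed.

(** All eigenvalues are nonnegative and zero is one of them, so it is the first
    entry of the spectrum; the remaining entries are the roots of the deflated
    determinant. *)
Lemma algebraic_connectivity_eigenfunction (R : rcfType) (T : finType) (e : rel T) :
  symmetric e -> (2 <= #|T|)%N ->
  exists f : T -> R, [/\ eigenfunction e (algebraic_connectivity e R) f,
    \sum_x f x = 0 & exists x, f x != 0].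
Proof.
move=> e_sym n2; set A := laplacian e R; set lam := algebraic_connectivity e R.
have n0 : (0 < #|T|)%N by apply: ltn_trans n2.
pose i0 : 'I_#|T| := Ordinal n0.
have symA : A^T = A.
  apply/matrixP => i j; rewrite !mxE e_sym; congr (_ - _).
  by have [->|ij] := eqVneq i j; rewrite // eq_sym (negPf ij).
have A1 : A *m const_mx 1 = 0 :> 'cV_#|T|.
  apply: trmx_inj; rewrite trmx_mul symA trmx0; apply/rowP => j.
  rewrite -(enum_valK j) laplacian_action // !mxE big1 // => y _.
  by rewrite !mxE subrr.
have [szs ss cE] := spectrum_sym symA.
have := char_poly_deflate (erefl : i0 = 0%N :> nat) A1; rewrite cE => cM.
have pos x : x \in spectrum A -> 0 <= x.
  rewrite -root_prod_XsubC -cE -eigenvalue_root_char => /eigenvalueP[v vA vn0].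
  have [j vj] : exists j, v 0 j != 0 by apply/rV0Pn.
  apply: (@eigenvalue_ge0 _ e R x (fun y => v 0 (enum_rank y)) (enum_val j)).
    by move=> y; rewrite -laplacian_action // vA mxE.
  by rewrite enum_valK.
have s0 : 0 \in spectrum A.
  by rewrite -root_prod_XsubC cM rootM rootX eqxx orbT.
rewrite /lam /algebraic_connectivity -/A.
case: (spectrum A) szs ss cM pos s0 => [|x [|y s]] /= szs; try by rewrite -szs in n2.
move=> ss cM pos s0.
have x0 : x = 0.
  apply/eqP; rewrite eq_le pos ?mem_head // andbT.
  move: s0; rewrite inE => /predU1P[<- //|].
  move: ss; rewrite -[X in is_true X -> _]/(path <=%R x (y :: s)).
  by rewrite (path_sortedE le_trans) => /andP[/allP xs _] /xs.
move: cM; rewrite big_cons x0 subr0 mulrC => /(mulIf (negbT (polyX_eq0 R))).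
move=> /(congr1 (fun p => root p y)); rewrite root_prod_XsubC mem_head => /esym.
case/(deflated_eigenvector A1) => g [gn0 gA gsum].
exists (fun x => g 0 (enum_rank x)); split.
- by move=> x1; rewrite -laplacian_action // gA mxE.
- by rewrite sum_enum_val -[RHS]gsum; apply: eq_bigr => j _; rewrite enum_valK.
by move: gn0 => /rV0Pn[j gj]; exists (enum_val j); rewrite enum_valK.
Qed.

(** * The lower bound *)

Theorem mainTheorem1 (R : rcfType) (T : finType) (e : rel T) (l : nat)
    (e_sym : symmetric e) (e_irr : irreflexive e)
    (n_ge2 : (2 <= #|T|)%N) (l_ge2 : (2 <= l)%N) :
  algebraic_connectivity e R >=
    4 * (num_ecc_le e R l)%:R
      / ((l%:R - 2 + 4 / #|T|%:R) * #|T|%:R ^+ 2).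
Proof.
have [f [fL f0 [x0 fx]]] := algebraic_connectivity_eigenfunction R e_sym n_ge2.
move: (algebraic_connectivity e R) fL => lam fL.
rewrite /num_ecc_le; set S := [set x | _].
have Sball u : S \subset ball e u l.
  by apply/subsetP => x; rewrite inE; apply: eccentricity_ball.
have n0 : 0 < #|T|%:R :> R by rewrite ltr0n (leq_trans _ n_ge2).
case: l l_ge2 @S Sball => [|[|k]] // _ S Sball.
have -> : (k.+2%:R - 2 + 4 / #|T|%:R) * #|T|%:R ^+ 2 =
    k%:R * #|T|%:R ^+ 2 + 4 * #|T|%:R :> R.
  by rewrite -addn2 natrD; field; rewrite gt_eqF.
rewrite ler_pdivrMr; last by rewrite ltr_wpDl ?mulr_gt0 // mulr_ge0 // exprn_ge0 // ltW.
case: k S Sball => [|k] S Sball; last exact: long_range_bound fL f0 fx Sball.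
have := two_step_bound e_sym e_irr fL f0 fx Sball; lra.
Qed.
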